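(* Let $\nu>0$. Then the function \[ x\mapsto \frac{1}{x^2}-\frac{x^{\nu-2}K_{\nu}(x)}{2^{\nu-1}\Gamma(\nu)} \] is a monotone decreasing function of $x$ on $(0,\infty)$. Moreover, it satisfies \[ 0<\frac{1}{x^2}-\frac{x^{\nu-2}K_{\nu}(x)}{2^{\nu-1}\Gamma(\nu)}\leq \frac{1}{4(\nu-1)}, \quad \text{for } x\geq 0,\ \nu>1, \] and the lower bound (strict positivity) is also valid for all $\nu>0$. At $x=0$ the expression is understood as its limit as $x\to 0^{+}$, taken in $[-\infty,+\infty]$.
   Context: All parameters and variables are real. $K_{\nu}(x)$ denotes the modified Bessel function of the second kind, which for $x>0$ and real $\nu$ is given by $K_\nu(x)=\int_0^\infty \mathrm{e}^{-x\cosh s}\cosh(\nu s)\,\mathrm{d}s$. $\Gamma$ is the gamma function. *)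

(* Defs.v *)
From mathcomp Require Import all_boot all_order all_algebra.
From mathcomp Require Import all_classical all_reals all_analysis.

Set Implicit Arguments.
Unset Strict Implicit.
Unset Printing Implicit Defensive.

Import Order.TTheory GRing.Theory Num.Theory.
Import numFieldNormedType.Exports.

Local Open Scope classical_set_scope.
Local Open Scope ring_scope.

Definition cosh {R : realType} (s : R) : R := (expR s + expR (- s)) / 2.

(* Euler's integral; [Rintegral] is [fine] of the extended integral, so the
   value is only meaningful where the integral is finite, i.e. for 0 < a. *)
Definition Gamma {R : realType} (a : R) : R :=
  (\int[lebesgue_measure]_(t in `]0, +oo[) (t `^ (a - 1) * expR (- t)))%R.

(* The modified Bessel function of the second kind; meaningful for 0 < x. *)
Definition besselK {R : realType} (nu x : R) : R :=
  (\int[lebesgue_measure]_(s in `[0, +oo[)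
     (expR (- (x * cosh s)) * cosh (nu * s)))%R.

Definition besselK_diff {R : realType} (nu x : R) : R :=
  1 / x ^+ 2 - x `^ (nu - 2) * besselK nu x / (2 `^ (nu - 1) * Gamma nu).

(* Extension to 0 <= x: the value at 0 is the right limit, taken in the
   extended reals because it is +oo when nu <= 1. *)
Definition besselK_diff_ext {R : realType} (nu x : R) : \bar R :=
  if x == 0 then lim ((besselK_diff nu y)%:E @[y --> 0^'+])
  else (besselK_diff nu x)%:E.

(* Main.v *)
Require Import Defs.
From mathcomp Require Import all_boot all_order all_algebra.
From mathcomp Require Import all_classical all_reals all_analysis.
From mathcomp Require Import measurable_realfun ring lra.

Import Order.TTheory GRing.Theory Num.Theory.
Import numFieldNormedType.Exports.

Local Open Scope classical_set_scope.
Local Open Scope ring_scope.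

(** The theorem follows from an integral representation in which everything
    that depends on x is an elementary function. Substituting
    t = (x / 2) * exp s in Bessel's integral gives

      2 (x / 2)^nu K_nu(x) = int_0^oo t^(nu-1) e^(-t) e^(-x^2 / (4 t)) dt,

    and the right-hand side without its last factor is Gamma nu. Subtracting,

      1/x^2 - x^(nu-2) K_nu(x) / (2^(nu-1) Gamma nu)
        = (1 / Gamma nu) int_0^oo t^(nu-1) e^(-t) (1 - e^(-x^2/(4t))) / x^2 dt

    ([besselK_diffE]). For fixed t the last factor is minus the slope of the
    chord from 0 to y = x^2 of the strictly convex function
    y |-> e^(-y/(4t)): it is positive, strictly decreasing in y, and at most
    its limit 1/(4t) at y = 0. Integration preserves these facts, strictness
    included ([lt_Rintegral]). Hence the function is positive and strictly
    decreasing, and for nu > 1 it is at most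
    Gamma (nu - 1) / (4 Gamma nu) = 1 / (4 (nu - 1)), by the functional
    equation [GammaD1]. The limit at 0 of a decreasing function is its
    supremum, which inherits both bounds.

    All integrals are over ]0, +oo[, where the integrands may blow up at 0.
    They are treated as increasing limits of integrals over the segments
    [c e^-n, c e^n], on which substitution and the fundamental theorem of
    calculus apply to continuous functions. *)

(** * Exhaustion of the half-line and the exponential substitution *)

Lemma pos_itv_bigcup {R : realType} {c : R} : 0 < c ->
  \bigcup_n `[c * expR (- n%:R), c * expR n%:R]%classic = `]0, +oo[%classic :> set R.
Proof.
move=> c0; apply/seteqP; split => x /=.
  move=> [n _] /=; rewrite !in_itv/= andbT => /andP[+ _].
  by apply: lt_le_trans; rewrite mulr_gt0// expR_gt0.
rewrite in_itv/= andbT => x0.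
exists (Num.bound `|ln (x / c)|) => //=.
have xc0 : 0 < x / c by rewrite divr_gt0.
have h := archi_boundP (normr_ge0 (ln (x / c))).
have [h1 h2] : - (Num.bound `|ln (x / c)|)%:R <= ln (x / c) /\
    ln (x / c) <= (Num.bound `|ln (x / c)|)%:R.
  by apply/andP; rewrite -ler_norml ltW.
rewrite in_itv/=; apply/andP; split.
  by rewrite mulrC -ler_pdivlMr// -[leRHS]lnK ?ler_expR// posrE.
by rewrite mulrC -ler_pdivrMr// -[leLHS]lnK ?ler_expR// posrE.
Qed.

Lemma real_itv_bigcup {R : realType} :
  \bigcup_n `[- n%:R, n%:R]%classic = [set: R].
Proof.
apply/seteqP; split => // x _.
exists (Num.bound `|x|) => //=.
by rewrite in_itv/= -ler_norml ltW// archi_boundP.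
Qed.

(** The segments are the images of [-n, n] under s |-> c * exp s, which makes
    them match the exhaustion of the line in the substitution below. *)
Lemma cvg_integral_pos_itv {R : realType} {c : R} {g : R -> R} : 0 < c ->
  measurable_fun (`]0, +oo[ : set R) g -> (forall t : R, 0 < t -> 0 <= g t) ->
  (\int[lebesgue_measure]_(t in `[(c * expR (- n%:R))%R, (c * expR n%:R)%R]) (g t)%:E)%E
    @[n --> \oo] --> (\int[lebesgue_measure]_(t in `]0%R, +oo[) (g t)%:E)%E.
Proof.
move=> c0 mg g0; rewrite -(pos_itv_bigcup c0).
apply: ge0_nondecreasing_set_cvg_integral.
- apply/nondecreasing_seqP => n; rewrite subsetEset; apply: subset_itv; rewrite bnd_simp.
    by rewrite ler_pM2l// ler_expR lerN2 ler_nat.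
  by rewrite ler_pM2l// ler_expR ler_nat.
- by move=> n; exact: measurable_itv.
- move=> n; apply/measurable_EFinP; apply: measurable_funS mg => //.
  by rewrite -(pos_itv_bigcup c0); move=> x hx; exists n.
- move=> n x /= h; rewrite lee_fin g0//.
  have: `]0, +oo[%classic x by rewrite -(pos_itv_bigcup c0); exists n.
  by rewrite /= in_itv/= andbT.
Qed.

Lemma cvg_integral_real_itv {R : realType} {g : R -> R} :
  measurable_fun setT g -> (forall t, 0 <= g t) ->
  (\int[lebesgue_measure]_(t in `[(- n%:R)%R, n%:R]) (g t)%:E)%E
    @[n --> \oo] --> (\int[lebesgue_measure]_t (g t)%:E)%E.
Proof.
move=> mg g0; rewrite -real_itv_bigcup.
apply: ge0_nondecreasing_set_cvg_integral.
- apply/nondecreasing_seqP => n; rewrite subsetEset; apply: subset_itv; rewrite bnd_simp.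
    by rewrite lerN2 ler_nat.
  by rewrite ler_nat.
- by move=> n; exact: measurable_itv.
- by move=> n; apply/measurable_EFinP; exact: measurable_funS mg.
- by move=> n x /= h; rewrite lee_fin g0.
Qed.

Lemma measurable_fun_pos {R : realType} {g : R -> R} :
  (forall t : R, 0 < t -> {for t, continuous g}) -> measurable_fun (`]0, +oo[ : set R) g.
Proof.
move=> cg; apply: open_continuous_measurable_fun; first exact: interval_open.
by move=> t; rewrite inE/= in_itv/= andbT; exact: cg.
Qed.

(** The change of variables t = c * exp s is made on each [-n, n], where the
    derivative is bounded and G is continuous up to the boundary; both sides are
    limits of these restrictions, possibly +oo. *)
Lemma integral_expR_substitution {R : realType} {c : R} {G : R -> R} : 0 < c ->
  (forall t : R, 0 < t -> {for t, continuous G}) -> (forall t, 0 < t -> 0 <= G t) ->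
  (\int[lebesgue_measure]_(t in `]0%R, +oo[) (G t)%:E =
   \int[lebesgue_measure]_s (G (c * expR s) * (c * expR s))%:E)%E.
Proof.
move=> c0 cG G0.
have dF (s : R) : is_derive s 1 (fun s => c * expR s) (c * expR s).
  by apply: is_derive_eq.
have F0 (s : R) : 0 < c * expR s by rewrite mulr_gt0// expR_gt0.
have dFE : (fun s : R => c * expR s)^`()%classic = (fun s => c * expR s).
  by apply/funext => s; rewrite derive1E; exact: derive_val.
have cF : continuous (fun s : R => c * expR s).
  by move=> s; apply: differentiable_continuous; apply/derivable1_diffP; exact: ex_derive.
have cGF : continuous (fun s : R => G (c * expR s) * (c * expR s)).
  move=> s; rewrite /continuous_at; apply: cvgM; last exact: cF.
  apply: (@continuous_comp _ _ _ (fun s => c * expR s) G); first exact: cF.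
  exact: cG.
have h1 := cvg_integral_pos_itv c0 (measurable_fun_pos cG) G0.
have h2 : (\int[lebesgue_measure]_(t in `[(- n%:R)%R, n%:R])
      (G (c * expR t) * (c * expR t))%:E)%E @[n --> \oo] --> (\int[lebesgue_measure]_t (G (c * expR t) * (c * expR t))%:E)%E.
  apply: (@cvg_integral_real_itv _ (fun t => G (c * expR t) * (c * expR t))).
    exact: continuous_measurable_fun.
  by move=> t; rewrite mulr_ge0 ?G0// ltW.
apply: (cvg_unique (@ereal_hausdorff R) h1).
move: h2; apply: cvg_trans; apply: near_eq_cvg; near=> n.
rewrite (@integration_by_substitution_increasing _ (fun s => c * expR s)) ?dFE//.
- by rewrite (@le_trans _ _ 0)// oppr_le0.
- by move=> x y _ _ xy; rewrite ltr_pM2l// ltr_expR.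
- by apply/cvg_ex; exists (c * expR (- n%:R)); apply: cvg_at_right_filter; exact: cF.
- by apply/cvg_ex; exists (c * expR n%:R); apply: cvg_at_left_filter; exact: cF.
- split.
  + by move=> x _; exact: ex_derive.
  + by apply: cvg_at_right_filter; exact: cF.
  + by apply: cvg_at_left_filter; exact: cF.
- apply: continuous_in_subspaceT => t; rewrite inE/= in_itv/= => /andP[+ _].
  by move=> /(lt_le_trans (F0 _)); exact: cG.
Unshelve. all: by end_near. Qed.

(** * The Gamma function *)

(** The function u^a e^(-u) is maximal at u = a, as seen by inserting
    ln (u / a) in the inequality 1 + v <= exp v. *)
Lemma powR_expRN_le {R : realType} {a u : R} : 0 < a -> 0 < u ->
  u `^ a * expR (- u) <= a `^ a * expR (- a).
Proof.
move=> a0 u0; rewrite /powR !gt_eqF// -!expRD ler_expR.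
have ua : 0 < u / a by rewrite divr_gt0.
have := expR_ge1Dx (ln (u / a)).
rewrite lnK ?posrE// ln_div ?posrE// => h.
have : (1 + (ln u - ln a)) * a <= u by rewrite -ler_pdivlMr.
lra.
Qed.

Lemma integral_FTC_pos {R : realType} {F f : R -> R} {a b : R} :
  0 < a -> a <= b ->
  (forall t : R, 0 < t -> is_derive t 1 F (f t)) ->
  (forall t : R, 0 < t -> {for t, continuous f}) ->
  (\int[lebesgue_measure]_(t in `[a, b]) (f t)%:E = (F b)%:E - (F a)%:E)%E.
Proof.
move=> a0; rewrite le_eqVlt => /predU1P[<- _ _|ab dF cf].
  by rewrite set_itv1 integral_set1 subee.
have cF (t : R) : 0 < t -> {for t, continuous F}.
  move=> t0; apply: differentiable_continuous; apply/derivable1_diffP.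
  by have [] := dF _ t0.
have b0 := lt_trans a0 ab.
apply: continuous_FTC2 => //.
- apply: continuous_in_subspaceT => t; rewrite inE/= in_itv/= => /andP[+ _].
  by move=> /(lt_le_trans a0); exact: cf.
- split.
  + move=> t; rewrite in_itv/= => /andP[/(lt_trans a0) t0 _].
    by have [] := dF _ t0.
  + by apply: cvg_at_right_filter; exact: cF.
  + by apply: cvg_at_left_filter; exact: cF.
- move=> t; rewrite in_itv/= => /andP[/(lt_trans a0) t0 _].
  by rewrite derive1E; have [_] := dF _ t0.
Qed.

Lemma powR_continuous_pos {R : realType} (a : R) {t : R} : 0 < t ->
  {for t, continuous (fun t => t `^ a)}.
Proof.
move=> t0; apply: differentiable_continuous; apply/derivable1_diffP.
by have [] := is_derive1_powR a t0.
Qed.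

Lemma expRN_continuous {R : realType} : continuous (fun t : R => expR (- t)).
Proof.
move=> t; apply: (@continuous_comp _ _ _ -%R expR).
  exact: opp_continuous.
exact: continuous_expR.
Qed.

Lemma Gamma_integrand_continuous {R : realType} (a : R) {t : R} : 0 < t ->
  {for t, continuous (fun t => t `^ a * expR (- t))}.
Proof.
move=> t0; rewrite /continuous_at; apply: cvgM; first exact: powR_continuous_pos.
exact: expRN_continuous.
Qed.

Lemma measurable_fun_itv_pos {R : realType} {a b : R} {h : R -> R} : 0 < a ->
  (forall t : R, 0 < t -> {for t, continuous h}) ->
  measurable_fun (`[a, b] : set R) h.
Proof.
move=> a0 /measurable_fun_pos; apply: measurable_funS => // t /=.
by rewrite !in_itv/= andbT => /andP[+ _]; exact: lt_le_trans.
Qed.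

(** Up to a constant, e^(-t) is at most (1 + t)^(-a-1), and
    t^(a-1) (1 + t)^(-a-1) has the primitive (t / (1 + t))^a / a, which is
    bounded on the whole half-line: this handles the singularity at 0 and the
    tail at once. *)
Lemma Gamma_integral_lty {R : realType} {a : R} : 0 < a ->
  (\int[lebesgue_measure]_(t in `]0%R, +oo[) (t `^ (a - 1) * expR (- t))%:E < +oo)%E.
Proof.
move=> a0.
(* The maximum of u^(a+1) e^(-u), times e because u = 1 + t. *)
pose C := (a + 1) `^ (a + 1) * expR (- (a + 1)) * expR 1.
pose f (t : R) : R := C / a * (a * (t / (1 + t)) `^ (a - 1) * (1 + t) ^- 2).
pose F (t : R) : R := C / a * (t / (1 + t)) `^ a.
have dF (t : R) : 0 < t -> is_derive t 1 F (f t).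
  move=> t0.
  have t1 : 1 + t != 0 by rewrite gt_eqF// addr_gt0.
  have du : is_derive t 1 (fun t => t / (1 + t)) ((1 + t) ^- 2).
    have d1 : is_derive t 1 (fun t => 1 + t) 1.
      by apply: is_derive_eq; rewrite add0r mulr1.
    have d2 := is_deriveM (is_derive_id t 1) (is_deriveV t1 d1).
    by apply: (is_derive_eq d2); rewrite /GRing.scale/=; field.
  have u0 : 0 < t / (1 + t) by rewrite divr_gt0// addr_gt0.
  have := is_deriveZ (C / a)
    (@is_derive1_comp _ (fun u => u `^ a) (fun t => t / (1 + t)) t _ _
      (is_derive1_powR a u0) du).
  by move=> H; exact: (is_derive_eq H).
have cf (t : R) : 0 < t -> {for t, continuous f}.
  move=> t0; rewrite /continuous_at.
  have t1 : 1 + t != 0 by rewrite gt_eqF// addr_gt0.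
  have u0 : 0 < t / (1 + t) by rewrite divr_gt0// addr_gt0.
  have c1 : (fun t : R => 1 + t) x @[x --> t] --> 1 + t.
    by apply: cvgD; [exact: cvg_cst|exact: cvg_id].
  have c2 : {for t, continuous (fun t : R => (t / (1 + t)) `^ (a - 1))}.
    apply: (@continuous_comp R R R (fun t : R => t / (1 + t))
      (fun u : R => u `^ (a - 1)) t).
      by rewrite /continuous_at; apply: cvgM; [exact: cvg_id|exact: cvgV].
    exact: powR_continuous_pos.
  apply: cvgM; first exact: cvg_cst.
  apply: cvgM.
    apply: cvgM; first exact: cvg_cst.
    exact: c2.
  by apply: cvgV; [rewrite expf_neq0|apply: cvgM].
have C0 : 0 <= C by rewrite /C !mulr_ge0// ?expR_ge0// powR_ge0.
have g0 (t : R) : 0 < t -> 0 <= t `^ (a - 1) * expR (- t).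
  by move=> _; rewrite mulr_ge0 ?powR_ge0 ?expR_ge0.
have gf (t : R) : 0 < t -> t `^ (a - 1) * expR (- t) <= f t.
  move=> t0.
  have t1 : 0 < 1 + t by rewrite addr_gt0.
  have t1n : 1 + t != 0 by rewrite gt_eqF.
  have -> : f t = t `^ (a - 1) * (C * (1 + t) `^ (- (a + 1))).
    rewrite /f -[in (t / (1 + t)) `^ _]powR_inv1 ?ltW// powRM ?powR_ge0 ?ltW// -powRrM.
    rewrite -powR_invn ?ltW//.
    have -> : - (a + 1) = -1 * (a - 1) + - 2 by ring.
    rewrite (@powRD _ (1 + t) (-1 * (a - 1))) ?t1n ?implybT//.
    by field; rewrite gt_eqF.
  rewrite ler_wpM2l ?powR_ge0// powRN ler_pdivlMr ?powR_gt0//.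
  have := @powR_expRN_le _ (a + 1) (1 + t) (addr_gt0 a0 ltr01) t1.
  rewrite -(ler_pM2r (expR_gt0 1)) -mulrA -expRD opprD addrAC addNr add0r.
  by rewrite mulrC.
have cg := cvg_integral_pos_itv ltr01
  (measurable_fun_pos (@Gamma_integrand_continuous _ (a - 1))) g0.
rewrite -(cvg_lim _ cg)//.
apply: (@le_lt_trans _ _ (C / a)%:E); last exact: ltry.
apply: lime_le; first by apply/cvg_ex; eexists; exact: cg.
apply: nearW => n; rewrite !mul1r.
have en0 : 0 < expR (- n%:R) :> R by exact: expR_gt0.
have enn : expR (- n%:R) <= expR n%:R :> R.
  by rewrite ler_expR (@le_trans _ _ 0)// oppr_le0.
have pos (t : R) : `[expR (- n%:R), expR n%:R]%classic t -> 0 < t.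
  by rewrite /= in_itv/= => /andP[+ _]; exact: lt_le_trans.
apply: (@le_trans _ _
    (\int[lebesgue_measure]_(t in `[expR (- n%:R), expR n%:R]) (f t)%:E)%E).
  apply: ge0_le_integral; first exact: measurable_itv.
  - by move=> t /pos t0; rewrite lee_fin g0.
  - apply/measurable_EFinP.
    exact: (measurable_fun_itv_pos en0 (@Gamma_integrand_continuous _ (a - 1))).
  - by apply/measurable_EFinP; exact: (measurable_fun_itv_pos en0 cf).
  - by move=> t /pos t0; rewrite lee_fin gf.
rewrite (integral_FTC_pos en0 enn dF cf) -EFinB lee_fin.
have Ca : 0 <= C / a by rewrite divr_ge0// ltW.
rewrite lerBlDr ler_wpDr//; first by rewrite /F mulr_ge0// powR_ge0.
rewrite /F -[leRHS]mulr1 ler_wpM2l//.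
have t0 : 0 < expR n%:R :> R by exact: expR_gt0.
have t1 : 0 < 1 + expR n%:R :> R by rewrite addr_gt0.
rewrite -[leRHS](_ : 1 `^ a = 1); last by rewrite powR1.
rewrite ge0_ler_powR ?nnegrE ?ltW// ?divr_gt0//.
by rewrite ltr_pdivrMr// mul1r ltrDr.
Qed.

Lemma Gamma_integrable {R : realType} {a : R} : 0 < a ->
  lebesgue_measure.-integrable `]0%R, +oo[
    (EFin \o (fun t : R => t `^ (a - 1) * expR (- t))).
Proof.
move=> a0; apply/integrableP; split.
  apply/measurable_EFinP; apply: measurable_fun_pos => t.
  exact: Gamma_integrand_continuous.
have := Gamma_integral_lty a0; congr (_ < _)%E; apply: eq_integral => t _ /=.
by rewrite ger0_norm// mulr_ge0 ?powR_ge0 ?expR_ge0.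
Qed.

Lemma Gamma_EFin {R : realType} {a : R} : 0 < a ->
  ((Gamma a)%:E =
   \int[lebesgue_measure]_(t in `]0%R, +oo[) (t `^ (a - 1) * expR (- t))%:E)%E.
Proof.
move=> a0; rewrite /Gamma /Rintegral fineK//.
by apply: integrable_fin_num => //; exact: Gamma_integrable.
Qed.

Lemma cvg_expRNn {R : realType} {a : R} : 0 < a -> expR (- (a * n%:R)) @[n --> \oo] --> 0.
Proof.
move=> a0; under eq_fun do rewrite -mulNr expRM_natr.
by apply: cvg_expr; rewrite ger0_norm ?expR_ge0// expR_lt1 oppr_lt0.
Qed.

(** Integrate by parts: the boundary term t^a e^(-t) vanishes at both ends. *)
Lemma GammaD1 {R : realType} {a : R} : 0 < a -> Gamma (a + 1) = a * Gamma a.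
Proof.
move=> a0.
pose F (t : R) : R := t `^ a * expR (- t).
pose f (t : R) : R := a * (t `^ (a - 1) * expR (- t)) - t `^ a * expR (- t).
have a1 : a + 1 - 1 = a by rewrite addrK.
have f1c (t : R) : 0 < t ->
    {for t, continuous (fun t : R => a * (t `^ (a - 1) * expR (- t)))}.
  move=> t0; rewrite /continuous_at; apply: cvgM; first exact: cvg_cst.
  exact: Gamma_integrand_continuous.
have f2c := @Gamma_integrand_continuous _ a.
have dF (t : R) : 0 < t -> is_derive t 1 F (f t).
  move=> t0.
  have dE : is_derive t 1 (fun t => expR (- t)) (- expR (- t)).
    by apply: is_derive_eq; rewrite mulrN1.
  apply: (is_derive_eq (is_deriveM (is_derive1_powR a t0) dE)).
  by rewrite /f /GRing.scale/=; ring.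
have cf (t : R) : 0 < t -> {for t, continuous f}.
  move=> t0; rewrite /continuous_at; apply: cvgB; first exact: f1c.
  exact: f2c.
have g10 (t : R) : 0 < t -> 0 <= a * (t `^ (a - 1) * expR (- t)).
  by move=> _; rewrite !mulr_ge0 ?powR_ge0 ?expR_ge0// ltW.
have g20 (t : R) : 0 < t -> 0 <= t `^ a * expR (- t).
  by move=> _; rewrite mulr_ge0 ?powR_ge0 ?expR_ge0.
have cg1 := cvg_integral_pos_itv ltr01 (measurable_fun_pos f1c) g10.
have cg2 := cvg_integral_pos_itv ltr01 (measurable_fun_pos f2c) g20.
have intI (h : R -> R) (n : nat) : (forall t : R, 0 < t -> {for t, continuous h}) ->
    lebesgue_measure.-integrable `[1 * expR (- n%:R), 1 * expR n%:R] (EFin \o h).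
  move=> ch; apply: continuous_compact_integrable; first exact: segment_compact.
  apply: continuous_in_subspaceT => t; rewrite inE/= in_itv/= => /andP[+ _].
  by rewrite mul1r => /(lt_le_trans (expR_gt0 _)); exact: ch.
have F0 : F (1 * expR n%:R) - F (1 * expR (- n%:R)) @[n --> \oo] --> 0.
  rewrite -[X in _ --> X]subr0; apply: cvgB.
    (* At the right end t^a e^(-t) <= max_u (u^(a+1) e^(-u)) / t. *)
    apply: (@squeeze_cvgr _ _ _ _ (cst 0) (fun n : nat =>
      (a + 1) `^ (a + 1) * expR (- (a + 1)) * expR (- (1 * n%:R)))).
    + apply: nearW => n; rewrite /F !mul1r mulr_ge0 ?powR_ge0 ?expR_ge0//=.
      have en : 0 < expR n%:R :> R by exact: expR_gt0.
      rewrite (expRN n%:R) ler_pdivlMr//.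
      have := powR_expRN_le (addr_gt0 a0 ltr01) en.
      rewrite (@powRD _ (expR n%:R)) ?(gt_eqF en) ?implybT//.
      by rewrite powRr1 ?expR_ge0// mulrAC.
    + exact: cvg_cst.
    + rewrite -[X in _ --> X](mulr0 ((a + 1) `^ (a + 1) * expR (- (a + 1)))).
      by apply: cvgM; [exact: cvg_cst|exact: cvg_expRNn].
  (* At the left end t^a e^(-t) <= t^a. *)
  apply: (@squeeze_cvgr _ _ _ _ (cst 0) (fun n : nat => expR (- (a * n%:R)))).
  + apply: nearW => n; rewrite /F !mul1r mulr_ge0 ?powR_ge0 ?expR_ge0//=.
    rewrite {1}/powR gt_eqF ?expR_gt0// expRK mulrN.
    by rewrite ler_piMr ?expR_ge0// expR_le1 oppr_le0 expR_ge0.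
  + exact: cvg_cst.
  + exact: cvg_expRNn.
have key n : (\int[lebesgue_measure]_(t in `[(1 * expR (- n%:R))%R, (1 * expR n%:R)%R])
      (a * (t `^ (a - 1) * expR (- t)))%:E =
    \int[lebesgue_measure]_(t in `[(1 * expR (- n%:R))%R, (1 * expR n%:R)%R])
      (t `^ a * expR (- t))%:E +
    (F (1 * expR n%:R) - F (1 * expR (- n%:R)))%:E)%E.
  have en : 0 < 1 * expR (- n%:R) :> R by rewrite mul1r expR_gt0.
  have enn : 1 * expR (- n%:R) <= 1 * expR n%:R :> R.
    by rewrite !mul1r ler_expR (@le_trans _ _ 0)// oppr_le0.
  rewrite EFinB -(integral_FTC_pos en enn dF cf) /f.
  under [X in (_ + X)%E]eq_integral do rewrite EFinB.
  rewrite integralB_EFin//; [|exact: intI..].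
  rewrite addeC subeK//.
  by apply: integrable_fin_num => //; exact: intI.
apply: EFin_inj; rewrite EFinM !Gamma_EFin ?addr_gt0// a1.
rewrite -ge0_integralZl_EFin//; last first.
- exact: ltW.
- apply/measurable_EFinP; apply: measurable_fun_pos => t.
  exact: Gamma_integrand_continuous.
- by move=> t _; rewrite lee_fin mulr_ge0 ?powR_ge0 ?expR_ge0.
apply/esym; apply: (cvg_unique (@ereal_hausdorff R) cg1).
rewrite /= (eq_cvg _ _ key).
have F0e : (F (1 * expR n%:R) - F (1 * expR (- n%:R)))%:E @[n --> \oo] --> 0%E.
  by apply: cvg_EFin => //; exact: nearW.
have := cvgeD _ cg2 F0e; rewrite adde0; apply.
by rewrite fin_num_adde_defl.
Qed.

(** * Bessel's integral as a damped Gamma integral *)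

Lemma ge0_integral_fold {R : realType} {h : R -> R} :
  continuous h -> (forall s, 0 <= h s) ->
  (\int[lebesgue_measure]_s (h s)%:E =
   \int[lebesgue_measure]_(s in `[0%R, +oo[) (h s + h (- s))%:E)%E.
Proof.
move=> ch h0.
have mh : measurable_fun [set: R] h by exact: continuous_measurable_fun.
have chN : continuous (fun s => h (- s)).
  by move=> s; apply: (@continuous_comp _ _ _ -%R h); [exact: opp_continuous|exact: ch].
have mhN : measurable_fun [set: R] (fun s => h (- s)) by exact: continuous_measurable_fun.
under [RHS]eq_integral do rewrite EFinD.
rewrite ge0_integralD//=.
- rewrite -(setUv [set` `[0%R, +oo[]) ge0_integral_setU//=.
  + congr (_ + _)%E; rewrite setCitvr/= integral_itv_bndo_bndc; last first.
      by apply/measurable_EFinP; exact: measurable_funS mh.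
    rewrite -{1}oppr0.
    by rewrite ge0_integration_by_substitutionNy//; exact: continuous_subspaceT.
  + exact: measurableC.
  + by rewrite setUv; apply/measurable_EFinP.
  + by move=> x _; rewrite lee_fin.
  + exact/disj_setPCl.
- by move=> s _; rewrite lee_fin.
- by apply/measurable_EFinP; exact: measurable_funS mh.
- by move=> s _; rewrite lee_fin.
- by apply/measurable_EFinP; exact: measurable_funS mhN.
Qed.

Lemma cosh_continuous {R : realType} : continuous (@cosh R).
Proof.
move=> s; rewrite /continuous_at /cosh; apply: cvgM; last exact: cvg_cst.
by apply: cvgD; [exact: continuous_expR|exact: expRN_continuous].
Qed.

Lemma coshN {R : realType} (s : R) : cosh (- s) = cosh s.
Proof. by rewrite /cosh opprK addrC. Qed.

Lemma cosh_ge0 {R : realType} (s : R) : 0 <= cosh s.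
Proof. by rewrite /cosh divr_ge0// addr_ge0// expR_ge0. Qed.

Lemma damping_continuous {R : realType} (y : R) {t : R} : 0 < t ->
  {for t, continuous (fun t : R => expR (- (y / t)))}.
Proof.
move=> t0.
have c : {for t, continuous (fun t : R => y / t)}.
  rewrite /continuous_at; apply: cvgM; first exact: cvg_cst.
  by apply: cvgV; [rewrite gt_eqF|exact: cvg_id].
exact: (@continuous_comp R R R (fun t : R => y / t) (fun u : R => expR (- u))
  t c (expRN_continuous _)).
Qed.

Lemma damped_Gamma_integrand_continuous {R : realType} (nu y : R) {t : R} : 0 < t ->
  {for t, continuous (fun t => t `^ (nu - 1) * expR (- t) * expR (- (y / t)))}.
Proof.
move=> t0; rewrite /continuous_at; apply: cvgM.
  exact: Gamma_integrand_continuous.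
exact: damping_continuous.
Qed.

Lemma powRB1_mulr {R : realType} (a : R) {t : R} : 0 < t -> t `^ (a - 1) * t = t `^ a.
Proof.
move=> t0; rewrite -{2}(powRr1 (ltW t0)) -powRD ?subrK//.
by rewrite (gt_eqF t0) implybT.
Qed.

(** With t = (x / 2) * exp s the exponent t + x^2 / (4 t) becomes x * cosh s,
    and t^(nu-1) dt becomes (x / 2)^nu * exp (nu * s) ds; folding the line at 0
    turns exp (nu * s) into 2 * cosh (nu * s). The identity is stated in the
    extended reals, so that finiteness of Bessel's integral is a consequence
    and not a premise. *)
Lemma integral_damped_Gamma {R : realType} {nu x : R} : 0 < x ->
  (\int[lebesgue_measure]_(t in `]0%R, +oo[)
     (t `^ (nu - 1) * expR (- t) * expR (- (x ^+ 2 / 4 / t)))%:E =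
   (2 * (x / 2) `^ nu)%:E *
   \int[lebesgue_measure]_(s in `[0%R, +oo[)
     (expR (- (x * cosh s)) * cosh (nu * s))%:E)%E.
Proof.
move=> x0.
have c0 : 0 < x / 2 by rewrite divr_gt0.
pose h (s : R) : R := (x / 2) `^ nu * (expR (nu * s) * expR (- (x * cosh s))).
have cE : continuous (fun s : R => expR (- (x * cosh s))).
  move=> s; apply: (@continuous_comp R R R (fun s : R => x * cosh s) (fun u => expR (- u))).
    by rewrite /continuous_at; apply: cvgM; [exact: cvg_cst|exact: cosh_continuous].
  exact: expRN_continuous.
have ch : continuous h.
  move=> s; rewrite /continuous_at; apply: cvgM; first exact: cvg_cst.
  apply: cvgM; last exact: cE.
  apply: (@continuous_comp R R R (fun s : R => nu * s) expR); last exact: continuous_expR.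
  by rewrite /continuous_at; apply: cvgM; [exact: cvg_cst|exact: cvg_id].
have h0 s : 0 <= h s by rewrite /h !mulr_ge0 ?powR_ge0 ?expR_ge0.
rewrite (integral_expR_substitution c0).
- under eq_integral => s _.
    have -> : (x / 2 * expR s) `^ (nu - 1) * expR (- (x / 2 * expR s)) *
        expR (- (x ^+ 2 / 4 / (x / 2 * expR s))) * (x / 2 * expR s) = h s.
      have t0 : 0 < x / 2 * expR s by rewrite mulr_gt0// expR_gt0.
      rewrite mulrAC [X in X * _]mulrAC powRB1_mulr// powRM ?expR_ge0 ?ltW//.
      have -> : expR s `^ nu = expR (nu * s) by rewrite /powR gt_eqF ?expR_gt0// expRK.
      rewrite /h -!mulrA; congr (_ * (_ * _)); rewrite mulrA -expRD; congr expR.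
      by rewrite /cosh expRN; field; rewrite !gt_eqF// expR_gt0.
    over.
  rewrite (ge0_integral_fold ch h0) -ge0_integralZl_EFin//.
  + apply: eq_integral => s _; congr EFin; rewrite /h coshN /cosh mulrN.
    by field.
  + by move=> s _; rewrite lee_fin mulr_ge0 ?expR_ge0 ?cosh_ge0.
  + apply/measurable_EFinP; apply: measurable_funTS; apply: continuous_measurable_fun => s.
    apply: cvgM; first exact: cE.
    apply: (@continuous_comp R R R (fun s : R => nu * s) cosh); last exact: cosh_continuous.
    by rewrite /continuous_at; apply: cvgM; [exact: cvg_cst|exact: cvg_id].
  + by rewrite mulr_ge0 ?powR_ge0.
- by move=> t; exact: damped_Gamma_integrand_continuous.
- by move=> t _; rewrite !mulr_ge0 ?powR_ge0 ?expR_ge0.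
Qed.

(** Applied below to the damping factor e^(-y/t) and to the chord slope, which
    are both bounded weights against t^(nu-1) e^(-t). *)
Lemma Gamma_weight_integrable {R : realType} {nu M : R} {w : R -> R} : 0 < nu ->
  (forall t : R, 0 < t -> {for t, continuous w}) ->
  (forall t : R, 0 < t -> `|w t| <= M) ->
  lebesgue_measure.-integrable `]0%R, +oo[
    (EFin \o (fun t : R => t `^ (nu - 1) * expR (- t) * w t)).
Proof.
move=> nu0 cw wM.
have ig : lebesgue_measure.-integrable `]0%R, +oo[
    (EFin \o (fun t : R => M * (t `^ (nu - 1) * expR (- t)))).
  exact: (integrableZl _ M (Gamma_integrable nu0)).
apply: le_integrable ig => //.
  apply/measurable_EFinP; apply: measurable_fun_pos => t t0.
  rewrite /continuous_at; apply: cvgM; last exact: cw.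
  exact: Gamma_integrand_continuous.
move=> t /=; rewrite in_itv/= andbT => t0.
rewrite lee_fin normrM mulrC [leRHS]normrM.
by rewrite ler_wpM2r// (le_trans (wM _ t0))// ler_norm.
Qed.

Lemma damping_itv {R : realType} {y t : R} : 0 <= y -> 0 < t ->
  0 <= expR (- (y / t)) <= 1.
Proof.
by move=> y0 t0; rewrite expR_ge0 expR_le1 oppr_le0 divr_ge0// ltW.
Qed.

Lemma damped_Gamma_integrable {R : realType} {nu y : R} : 0 < nu -> 0 <= y ->
  lebesgue_measure.-integrable `]0%R, +oo[
    (EFin \o (fun t : R => t `^ (nu - 1) * expR (- t) * expR (- (y / t)))).
Proof.
move=> nu0 y0; apply: (@Gamma_weight_integrable _ _ 1) => // t t0.
  exact: damping_continuous.
by have /andP[h0 h1] := damping_itv y0 t0; rewrite ger0_norm.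
Qed.

Lemma besselK_damped_Gamma {R : realType} {nu x : R} : 0 < nu -> 0 < x ->
  2 * (x / 2) `^ nu * besselK nu x =
  \int[lebesgue_measure]_(t in `]0, +oo[)
     (t `^ (nu - 1) * expR (- t) * expR (- (x ^+ 2 / 4 / t))).
Proof.
move=> nu0 x0.
set J := (RHS).
have c0 : 0 < 2 * (x / 2) `^ nu by rewrite mulr_gt0// powR_gt0// divr_gt0.
have y0 : 0 <= x ^+ 2 / 4 by rewrite divr_ge0// sqr_ge0.
have EJ : (J%:E = (2 * (x / 2) `^ nu)%:E *
   \int[lebesgue_measure]_(s in `[0%R, +oo[)
     (expR (- (x * cosh s)) * cosh (nu * s))%:E)%E.
  rewrite -integral_damped_Gamma// /J /Rintegral fineK//.
  by apply: integrable_fin_num => //; exact: damped_Gamma_integrable.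
rewrite /besselK /Rintegral.
have -> : (\int[lebesgue_measure]_(s in `[0%R, +oo[)
     (expR (- (x * cosh s)) * cosh (nu * s))%:E = ((2 * (x / 2) `^ nu)^-1 * J)%:E)%E.
  by rewrite EFinM EJ muleA -EFinM mulVf ?gt_eqF// mul1e.
by rewrite /= mulrA mulfV ?mul1r// gt_eqF.
Qed.

(** * Strict comparison of integrals *)

(** If the integral of the positive function g - f were zero, this function
    would vanish almost everywhere on D, making D negligible. *)
Lemma lt_Rintegral {d : measure_display} {T : measurableType d} {R : realType}
    {mu : {measure set T -> \bar R}} {D : set T} {f g : T -> R} :
  measurable D -> (0 < mu D)%E ->
  mu.-integrable D (EFin \o f) -> mu.-integrable D (EFin \o g) ->
  (forall x, D x -> f x < g x) ->
  \int[mu]_(x in D) f x < \int[mu]_(x in D) g x.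
Proof.
move=> mD D0 intf intg fg; rewrite -subr_gt0 -RintegralB//.
have d0 x : D x -> 0 <= g x - f x by move=> Dx; rewrite subr_ge0 ltW// fg.
rewrite lt_neqAle Rintegral_ge0// andbT eq_sym; apply/eqP => I0.
have intd : mu.-integrable D (EFin \o (fun x => g x - f x)).
  by have := integrableB mD intg intf; apply: eq_integrable.
have I0E : (\int[mu]_(x in D) `|(g x - f x)%:E| = 0)%E.
  transitivity (\int[mu]_(x in D) (g x - f x)%:E)%E.
    by apply: eq_integral => x /set_mem Dx; rewrite gee0_abs// lee_fin d0.
  by rewrite -[LHS]fineK ?integrable_fin_num//; congr EFin; exact: I0.
have /(ae_eq_integral_abs mu mD (measurable_int mu intd)) negl := I0E.
move: D0; rewrite (measure_negligible mD) ?ltxx//.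
apply: negligibleS negl => x Dx /= /(_ Dx) /eqP.
by rewrite eqe subr_eq0 gt_eqF// fg.
Qed.

Lemma lebesgue_measure_pos_gt0 {R : realType} :
  (0 < lebesgue_measure (`]0%R, +oo[ : set R))%E.
Proof. by rewrite lebesgue_measure_itv/= ltry sube0 ltry. Qed.

Lemma Gamma_gt0 {R : realType} {nu : R} : 0 < nu -> 0 < Gamma nu.
Proof.
move=> nu0.
have <- : \int[lebesgue_measure]_(t in `]0, +oo[) (0 : R) = 0.
  by rewrite /Rintegral integral0.
apply: lt_Rintegral => //.
- exact: lebesgue_measure_pos_gt0.
- exact: integrable0.
- exact: Gamma_integrable.
- by move=> t /=; rewrite in_itv/= andbT => t0; rewrite mulr_gt0 ?powR_gt0 ?expR_gt0.
Qed.

(** * The slope of the exponential *)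

(** Minus the slope of the chord of y |-> exp (- y / u) between 0 and y. The
    parameter u stands for 4 * t. *)
Definition expR_slope {R : realType} (u y : R) : R := (1 - expR (- (y / u))) / y.

Lemma expR_slope_gt0 {R : realType} {u y : R} : 0 < u -> 0 < y -> 0 < expR_slope u y.
Proof.
by move=> u0 y0; rewrite /expR_slope divr_gt0// subr_gt0 expR_lt1 oppr_lt0 divr_gt0.
Qed.

Lemma expR_slope_le {R : realType} {u y : R} : 0 < u -> 0 < y -> expR_slope u y <= u^-1.
Proof.
move=> u0 y0; rewrite /expR_slope ler_pdivrMr//.
have := expR_ge1Dx (- (y / u)); rewrite [u^-1 * y]mulrC; lra.
Qed.

(** Strict convexity: y is the barycentre of 0 and z with weights z - y and y,
    and the exponential lies above its tangent at y, strictly so at 0. *)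
Lemma expR_slope_decreasing {R : realType} {u y z : R} : 0 < u -> 0 < y -> y < z ->
  expR_slope u z < expR_slope u y.
Proof.
move=> u0 y0 yz; have z0 := lt_trans y0 yz.
rewrite /expR_slope ltr_pdivrMr// mulrAC ltr_pdivlMr//.
(* The tangent at y, evaluated at 0 and then at z. *)
have h1 : expR (- (y / u)) * (1 + y / u) < 1.
  rewrite -[ltRHS]expR0 -(addNr (y / u)) expRD.
  by rewrite ltr_pM2l ?expR_gt0// expR_gt1Dx// gt_eqF// divr_gt0.
have h2 : expR (- (y / u)) * (1 - (z - y) / u) <= expR (- (z / u)).
  have -> : - (z / u) = - (y / u) + - ((z - y) / u) by ring.
  by rewrite expRD ler_pM2l ?expR_gt0// expR_ge1Dx.
have zy : 0 < z - y by rewrite subr_gt0.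
move: h1 h2; rewrite -(ltr_pM2l zy) -(ler_pM2l y0).
move: (expR (- (y / u))) (expR (- (z / u))) (u^-1) => p q v; lra.
Qed.

(** * The Bessel difference *)

(** Subtracting the damped integral from Gamma nu leaves the factor
    1 - e^(-x^2/(4t)); divided by x^2 it is a chord slope in the variable x^2. *)
Lemma besselK_diffE {R : realType} {nu x : R} : 0 < nu -> 0 < x ->
  besselK_diff nu x =
  (\int[lebesgue_measure]_(t in `]0, +oo[)
     (t `^ (nu - 1) * expR (- t) * expR_slope (4 * t) (x ^+ 2))) / Gamma nu.
Proof.
move=> nu0 x0.
have y0 : 0 <= x ^+ 2 / 4 by rewrite divr_ge0// sqr_ge0.
have G0 := Gamma_gt0 nu0.
have x2 : 0 < x `^ nu by rewrite powR_gt0.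
have p2 : 0 < 2 `^ nu :> R by rewrite powR_gt0.
have -> : besselK_diff nu x =
    (Gamma nu - 2 * (x / 2) `^ nu * besselK nu x) / x ^+ 2 / Gamma nu.
  have -> : (x / 2) `^ nu = x `^ nu / 2 `^ nu.
    by rewrite powRM ?invr_ge0 ?ltW// -[2^-1]powR_inv1// -powRrM mulN1r powRN.
  rewrite /besselK_diff.
  have -> : x `^ (nu - 2) = x `^ nu / x ^+ 2.
    by rewrite powRD ?(gt_eqF x0) ?implybT// powR_invn// ltW.
  have -> : 2 `^ (nu - 1) = 2 `^ nu / 2 :> R.
    by rewrite powRD ?(@gt_eqF _ _ 2) ?implybT// powR_inv1.
  by field; rewrite !gt_eqF.
rewrite besselK_damped_Gamma// /Gamma -RintegralB//; last 2 first.
- exact: Gamma_integrable.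
- exact: damped_Gamma_integrable.
congr (_ / _); rewrite mulrC -RintegralZl//.
  apply: eq_Rintegral => t; rewrite inE/= in_itv/= andbT => t0.
  rewrite /expR_slope invfM [_^-1 * _]mulrC.
  have -> : x ^+ 2 / (4 * t) = x ^+ 2 / 4 / t by rewrite invfM mulrA.
  by ring.
have := integrableB _ (Gamma_integrable nu0) (damped_Gamma_integrable nu0 y0).
by apply.
Qed.

Lemma expR_slope_weight_continuous {R : realType} (y : R) {t : R} : 0 < t ->
  {for t, continuous (fun t : R => expR_slope (4 * t) y)}.
Proof.
move=> t0; rewrite /continuous_at; apply: cvgM; last exact: cvg_cst.
apply: cvgB; first exact: cvg_cst.
have -> : (fun t : R => expR (- (y / (4 * t)))) = (fun t => expR (- (y / 4 / t))).
  by apply/funext => s; rewrite invfM mulrA.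
by rewrite invfM mulrA; exact: damping_continuous.
Qed.

Lemma expR_slope_weight_integrable {R : realType} {nu y : R} : 0 < nu -> 0 < y ->
  lebesgue_measure.-integrable `]0%R, +oo[
    (EFin \o (fun t : R => t `^ (nu - 1) * expR (- t) * expR_slope (4 * t) y)).
Proof.
move=> nu0 y0; apply: (@Gamma_weight_integrable _ _ y^-1) => // t t0.
  exact: expR_slope_weight_continuous.
rewrite ger0_norm; last by rewrite ltW// expR_slope_gt0// mulr_gt0.
by rewrite /expR_slope ler_piMl ?gerBl ?expR_ge0// invr_ge0 ltW.
Qed.

Lemma besselK_diff_gt0 {R : realType} {nu x : R} : 0 < nu -> 0 < x ->
  0 < besselK_diff nu x.
Proof.
move=> nu0 x0; have y0 : 0 < x ^+ 2 by rewrite exprn_gt0.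
rewrite besselK_diffE// divr_gt0 ?Gamma_gt0//.
have {1}<- : \int[lebesgue_measure]_(t in `]0, +oo[) (0 : R) = 0.
  by rewrite /Rintegral integral0.
apply: lt_Rintegral => //.
- exact: lebesgue_measure_pos_gt0.
- exact: integrable0.
- exact: expR_slope_weight_integrable.
- move=> t /=; rewrite in_itv/= andbT => t0.
  by rewrite mulr_gt0 ?expR_slope_gt0 ?mulr_gt0 ?powR_gt0 ?expR_gt0.
Qed.

Lemma besselK_diff_decreasing {R : realType} {nu x y : R} : 0 < nu -> 0 < x -> x < y ->
  besselK_diff nu y < besselK_diff nu x.
Proof.
move=> nu0 x0 xy; have y0 := lt_trans x0 xy.
rewrite !besselK_diffE// ltr_pM2r ?invr_gt0 ?Gamma_gt0//.
apply: lt_Rintegral => //.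
- exact: lebesgue_measure_pos_gt0.
- by apply: expR_slope_weight_integrable; rewrite ?exprn_gt0.
- by apply: expR_slope_weight_integrable; rewrite ?exprn_gt0.
- move=> t /=; rewrite in_itv/= andbT => t0.
  rewrite ltr_pM2l ?mulr_gt0 ?powR_gt0 ?expR_gt0//.
  by rewrite expR_slope_decreasing ?mulr_gt0 ?exprn_gt0// ltr_pXn2r ?nnegrE ?ltW.
Qed.

(** Bounding the slope by its value 1 / (4 t) at y = 0 lowers the exponent of t
    by one, which leaves Gamma (nu - 1) / 4. *)
Lemma besselK_diff_le {R : realType} {nu x : R} : 1 < nu -> 0 < x ->
  besselK_diff nu x <= 1 / (4 * (nu - 1)).
Proof.
move=> nu1 x0; have nu0 := lt_trans ltr01 nu1.
have a0 : 0 < nu - 1 by rewrite subr_gt0.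
have y0 : 0 < x ^+ 2 by rewrite exprn_gt0.
rewrite besselK_diffE// ler_pdivrMr ?Gamma_gt0//.
have -> : 1 / (4 * (nu - 1)) * Gamma nu = 4^-1 * Gamma (nu - 1).
  by rewrite -{2}(subrK 1 nu) GammaD1//; field; rewrite gt_eqF.
rewrite /Gamma -RintegralZl//; last exact: Gamma_integrable.
apply: le_Rintegral => //.
- exact: expR_slope_weight_integrable.
- exact: (integrableZl _ 4^-1 (Gamma_integrable a0)).
- move=> t /=; rewrite in_itv/= andbT => t0.
  have -> : 4^-1 * (t `^ (nu - 1 - 1) * expR (- t)) =
      t `^ (nu - 1) * expR (- t) * (4 * t)^-1.
    by rewrite -[in RHS](powRB1_mulr _ t0); field; rewrite gt_eqF.
  by rewrite ler_wpM2l ?mulr_ge0 ?powR_ge0 ?expR_ge0// expR_slope_le// mulr_gt0.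
Qed.

Theorem theorem3p1 (R : realType) (nu : R) (hnu : 0 < nu) :
  {in `]0, +oo[ &, {homo besselK_diff nu : x y / x < y >-> y < x}} /\
  cvg ((besselK_diff nu y)%:E @[y --> 0^'+]) /\
  (forall x : R, 0 <= x -> (0 < besselK_diff_ext nu x)%E) /\
  (1 < nu -> forall x : R, 0 <= x ->
     (0 < besselK_diff_ext nu x <= (1 / (4 * (nu - 1)))%:E)%E).
Proof.
have decr : {in `]0, +oo[ &, {homo besselK_diff nu : x y / x < y >-> y < x}}.
  by move=> x y; rewrite in_itv/= andbT => x0 _; exact: besselK_diff_decreasing.
(* The value at 0 is a supremum, possibly +oo. *)
have cvg0 : (besselK_diff nu y)%:E @[y --> 0^'+] -->
    ereal_sup ((fun y => (besselK_diff nu y)%:E) @` `]0, +oo[).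
  apply: (@nonincreasing_at_right_cvge _ (fun y => (besselK_diff nu y)%:E) 0 +oo%O) => //.
  move=> x y xI yI; rewrite le_eqVlt => /predU1P[->//|xy].
  by rewrite lee_fin ltW// decr.
have lim0 : lim ((besselK_diff nu y)%:E @[y --> 0^'+]) =
    ereal_sup ((fun y => (besselK_diff nu y)%:E) @` `]0, +oo[).
  exact: cvg_lim cvg0.
have pos (x : R) : 0 <= x -> (0 < besselK_diff_ext nu x)%E.
  rewrite le_eqVlt /besselK_diff_ext => /predU1P[<-|x0].
    rewrite eqxx lim0; apply: (@lt_le_trans _ _ (besselK_diff nu 1)%:E).
      by rewrite lte_fin besselK_diff_gt0.
    by apply: ereal_sup_ubound; exists 1 => //=; rewrite in_itv/= ltr01.
  by rewrite gt_eqF// lte_fin besselK_diff_gt0.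
split=> //; split; first by apply/cvg_ex; eexists; exact: cvg0.
split=> // nu1 x x0; rewrite pos//=.
move: x0; rewrite le_eqVlt /besselK_diff_ext => /predU1P[<-|x0].
  rewrite eqxx lim0; apply: ge_ereal_sup => _ [y /= + <-].
  by rewrite in_itv/= andbT lee_fin => y0; exact: besselK_diff_le.
by rewrite gt_eqF// lee_fin besselK_diff_le.
Qed.
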